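(* Let $X$ be a finite CW complex, let $\mathcal{A}$ be the Morse arrangement on $\mathbb{R}^X$, let $\mathcal{L}(\mathcal{A})$ be the intersection poset of $\mathcal{A}$, and let $\mathfrak{M}(X)$ be the complex of discrete Morse matchings on $X$ (identified with its face poset). Then there is a canonical embedding of posets $\mathfrak{M}(X)\subset\mathcal{L}(\mathcal{A})$.
   Context: $X$ also denotes its set of cells. A cell $\sigma$ is a face of $\tau$ if $\sigma\subseteq\tau$ (containment of closed cells); the face poset $F(X)$ is the set of cells ordered by the face relation. A cover relation $\sigma\subset\tau$ is a relation $\sigma<\tau$ in $F(X)$ with no cell strictly in between. The Hasse diagram $D(X)$ is the directed graph with vertex set $F(X)$ and an edge $(\tau,\sigma)$ for each cover relation $\sigma\subset\tau$. $\mathbb{R}^X$ is the space of all functions from the set of cells to $\mathbb{R}$. The Morse arrangement is $\mathcal{A}=\{H_\sigma^\tau\mid \sigma\subset\tau\text{ a cover relation in }F(X)\}$, where $H_\sigma^\tau=\{x\in\mathbb{R}^X\mid x_\sigma=x_\tau\}$. The intersection poset $\mathcal{L}(\mathcal{A})$ is the set of all intersections of subfamilies of $\mathcal{A}$, ordered by reverse inclusion. A matching on $D(X)$ is a set of edges no two of which share a vertex; it is acyclic if the directed graph obtained from $D(X)$ by reversing the edges of the matching has no directed cycles. A $p$-cell $\sigma$ is a regular face of a $(p+1)$-cell $\tau$ with characteristic map $h$ if $h$ restricts to a homeomorphism $h^{-1}(\sigma)\to\sigma$ (open cell $\sigma$) and the closure of $h^{-1}(\sigma)$ is a closed $p$-ball.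 The complex of discrete Morse matchings $\mathfrak{M}(X)$ is the simplicial complex whose vertices are the cover relations in $F(X)$ that correspond to regular faces and whose simplices are the sets of vertices that correspond to acyclic matchings on $D(X)$. It is not distinguished from its face poset, i.e. its simplices ordered by inclusion. *)

(* Defs.v *)
From HB Require Import structures.
From mathcomp Require Import all_boot all_order all_algebra.
From mathcomp Require Import all_classical all_reals all_analysis.

Set Implicit Arguments.
Unset Strict Implicit.
Unset Printing Implicit Defensive.

Import Order.TTheory GRing.Theory Num.Theory.
Import numFieldNormedType.Exports.

Local Open Scope classical_set_scope.
Local Open Scope ring_scope.

(* [f] restricts to a homeomorphism from [A] onto [B], both with the subspace
   topology; the values of [f] outside [A] are irrelevant. *)
Definition homeomorphism_on (T : ptopologicalType) (U : topologicalType)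
    (A : set T) (B : set U) (f : T -> U) : Prop :=
  [/\ set_bij A B f, {within A, continuous f} &
      exists2 g : U -> T, {in A, cancel f g} & {within B, continuous g}].

Definition homeomorphic (T U : ptopologicalType) (A : set T) (B : set U) : Prop :=
  exists f : T -> U, homeomorphism_on A B f.

(* The disks are Euclidean: the norm of ['rV[R]_n] in the library is the sup
   norm, so the Euclidean one is written out. For [n = 0] both disks are the
   point and the sphere is empty. *)
Section Disks.
Variables (R : realType) (n : nat).

Definition closed_disk : set 'rV[R]_n := [set x | \sum_i x 0 i ^+ 2 <= 1].
Definition open_disk : set 'rV[R]_n := [set x | \sum_i x 0 i ^+ 2 < 1].
Definition unit_sphere : set 'rV[R]_n := [set x | \sum_i x 0 i ^+ 2 = 1].

End Disks.

Arguments closed_disk {R} n.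
Arguments open_disk {R} n.
Arguments unit_sphere {R} n.

(* Since there are finitely many cells, closure-finiteness and the weak topology
   are automatic. The characteristic map of a cell is a total function of which
   only the values on the closed disk matter. *)
Record finite_cw (R : realType) := FiniteCW {
  cw_space : topologicalType;
  cw_cell :> finType;
  cw_dim : cw_cell -> nat;
  cw_map : forall s : cw_cell, 'rV[R]_(cw_dim s) -> cw_space;
  cw_hausdorff : hausdorff_space cw_space;
  cw_map_continuous : forall s : cw_cell,
    {within closed_disk (cw_dim s), continuous (@cw_map s)};
  cw_map_homeo : forall s : cw_cell,
    homeomorphism_on (open_disk (cw_dim s))
      (@cw_map s @` open_disk (cw_dim s)) (@cw_map s);
  cw_disjoint :
    trivIset setT (fun s => @cw_map s @` open_disk (cw_dim s));
  cw_cover :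
    \bigcup_s (@cw_map s @` open_disk (cw_dim s)) = setT;
  cw_attach : forall s : cw_cell,
    @cw_map s @` unit_sphere (cw_dim s) `<=`
    \bigcup_(t in [set t | (cw_dim t < cw_dim s)%N])
      (@cw_map t @` open_disk (cw_dim t))
}.

Arguments cw_dim {R X} s : rename.
Arguments cw_map {R X} s v : rename.

Section Cells.
Variables (R : realType) (X : finite_cw R).
Implicit Types s t : X.

Definition open_cell s : set (cw_space X) :=
  cw_map s @` open_disk (cw_dim s).

Definition closed_cell s : set (cw_space X) := closure (open_cell s).

Lemma closed_disk_compact n : compact (@closed_disk R n).
Proof.
have cube : compact
    [set v : 'rV[R]_n | forall i, (`[-1, 1]%classic : set R) (v ord0 i)].
  by apply: (@rV_compact R n (fun=> `[-1, 1]%classic)) => i; exact: segment_compact.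
apply: subclosed_compact cube _.
  apply: (@preimage_closed _ _ (fun v : 'rV[R]_n => \sum_i v 0 i ^+ 2)
    [set r | r <= 1]); last exact: closed_le.
  move=> v _; apply: continuous_big => [|i _ {}v]; first exact: add_continuous.
  apply: (@continuous_comp _ _ _ (fun v : 'rV[R]_n => v 0 i) (fun r => r ^+ 2)).
    exact: coord_continuous.
  exact: exprn_continuous.
move=> v /= v1 i; rewrite /= in_itv /= -ler_norml -(@expr_le1 _ 2%N) //.
rewrite real_normK ?num_real //; apply: le_trans v1.
by rewrite (bigD1 i) //= lerDl sumr_ge0 // => j _; exact: sqr_ge0.
Qed.

Lemma open_cell_neq0 s : open_cell s !=set0.
Proof.
exists (cw_map s 0); exists 0 => //=.
by rewrite /open_disk /= big1 // => i _; rewrite mxE expr0n.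
Qed.

Lemma open_cell_eq s t x : open_cell s x -> open_cell t x -> s = t.
Proof. by move=> sx tx; apply: (@cw_disjoint R X s t) => //; exists x. Qed.

Lemma closed_cellP s x : closed_cell s x ->
  open_cell s x \/ exists2 t, (cw_dim t < cw_dim s)%N & open_cell t x.
Proof.
have disk_closed : closed (cw_map s @` closed_disk (cw_dim s)).
  apply: compact_closed; first exact: cw_hausdorff.
  apply: continuous_compact; first exact: cw_map_continuous.
  exact: closed_disk_compact.
move=> sx; have [v v1 <-] : (cw_map s @` closed_disk (cw_dim s)) x.
  apply: disk_closed; apply: closureS sx.
  by apply: image_subset => v; exact: ltW.
move: v1; rewrite /closed_disk /= le_eqVlt => /orP[/eqP v1|v1]; last first.
  by left; exists v.
have [|t ts tv] := @cw_attach R X s (cw_map s v); first by exists v.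
by right; exists t.
Qed.

Lemma closed_cell_sub s t :
  closed_cell s `<=` closed_cell t -> s = t \/ (cw_dim s < cw_dim t)%N.
Proof.
move=> st; have [x sx] := open_cell_neq0 s.
have /st/closed_cellP[tx|[u ut ux]] : closed_cell s x by exact: subset_closure.
  by left; exact: open_cell_eq sx tx.
by right; rewrite (open_cell_eq sx ux).
Qed.

End Cells.

(* The cells of [X] under an alias that carries the face relation as its order. *)
Definition face_poset (R : realType) (X : finite_cw R) : Type := cw_cell X.

HB.instance Definition _ (R : realType) (X : finite_cw R) :=
  Finite.on (face_poset X).

Section FacePoset.
Variables (R : realType) (X : finite_cw R).

Definition face_le (s t : face_poset X) : bool :=
  `[< closed_cell s `<=` closed_cell t >].

Lemma face_le_refl : reflexive face_le.
Proof. by move=> s; apply/asboolP. Qed.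

Lemma face_le_anti : antisymmetric face_le.
Proof.
move=> s t /andP[/asboolP st /asboolP ts].
have [//|lt_st] := closed_cell_sub st.
have [//|lt_ts] := closed_cell_sub ts.
by have := ltn_trans lt_st lt_ts; rewrite ltnn.
Qed.

Lemma face_le_trans : transitive face_le.
Proof.
move=> t s u /asboolP st /asboolP tu.
by apply/asboolP; exact: subset_trans st tu.
Qed.

End FacePoset.

Fact face_display : Order.disp_t. Proof. by []. Qed.

HB.instance Definition _ (R : realType) (X : finite_cw R) :=
  Order.Le_isPOrder.Build face_display (face_poset X)
    (@face_le_refl R X) (@face_le_anti R X) (@face_le_trans R X).

Definition covers (d : Order.disp_t) (P : finPOrderType d) (s t : P) : bool :=
  (s < t)%O && [forall r : P, ~~ ((s < r)%O && (r < t)%O)].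

(* Directed graphs on [T] are relations, with [D u v] meaning that [(u, v)] is
   an edge. *)
Section Matchings.
Variables (T : finType) (D : rel T).
Implicit Types M : {set T * T}.

Definition matching M : Prop :=
  (forall e, e \in M -> D e.1 e.2) /\
  {in M &, forall e f v,
    v \in [:: e.1; e.2] -> v \in [:: f.1; f.2] -> e = f}.

Definition reverse_edges M : rel T :=
  [rel u v | (D u v && ((u, v) \notin M)) || ((v, u) \in M)].

(* [cycle e c] is satisfied by the empty sequence, which is not a directed cycle. *)
Definition acyclic (e : rel T) : Prop :=
  forall c : seq T, cycle e c -> c = [::].

Definition acyclic_matching M : Prop :=
  matching M /\ acyclic (reverse_edges M).

End Matchings.

Section Morse.
Variables (R : realType) (X : finite_cw R).
Implicit Types s t : face_poset X.

Definition hasse_diagram : rel (face_poset X) := [rel t s | covers s t].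

Definition cell_preimage s t : set 'rV[R]_(cw_dim t) :=
  closed_disk (cw_dim t) `&` cw_map t @^-1` open_cell s.

Arguments cell_preimage s t : clear implicits.

(* The closure of the preimage in the Euclidean space is also its closure in the
   closed disk. *)
Definition regular_face s t : Prop :=
  [/\ cw_dim t = (cw_dim s).+1,
      homeomorphism_on (cell_preimage s t) (open_cell s) (cw_map t) &
      homeomorphic (closure (cell_preimage s t)) (@closed_disk R (cw_dim s))].

(* As an edge of the Hasse diagram, the cover relation [s] < [t] is the pair
   [(t, s)], the larger cell coming first. *)
Definition regular_covers : {set face_poset X * face_poset X} :=
  [set e | covers e.2 e.1 && `[< regular_face e.2 e.1 >]]%SET.

Definition morse_complex : {set {set face_poset X * face_poset X}} :=
  [set M : {set face_poset X * face_poset X} |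
    (M \subset regular_covers) && `[< acyclic_matching hasse_diagram M >]]%SET.

Definition hyperplane s t : set (X -> R) := [set x | x s = x t].

Definition morse_arrangement : set (set (X -> R)) :=
  [set hyperplane p.1 p.2 | p in [set p | covers p.1 p.2]].

Definition intersections (T : Type) (A : set (set T)) : set (set T) :=
  [set S | exists2 B, B `<=` A & S = \bigcap_(H in B) H].

End Morse.

Arguments hasse_diagram {R} X.
Arguments regular_covers {R} X.
Arguments morse_complex {R} X.
Arguments morse_arrangement {R} X.

Import Order.DefaultSetSubsetOrder.

(* The poset of simplices of the complex of discrete Morse matchings, ordered by
   inclusion; it contains the empty matching. *)
Record morse_matching (R : realType) (X : finite_cw R) := MorseMatching {
  matching_edges :> {set face_poset X * face_poset X};
  _ : matching_edges \in morse_complex X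
}.

HB.instance Definition _ (R : realType) (X : finite_cw R) :=
  [isSub for @matching_edges R X].
HB.instance Definition _ (R : realType) (X : finite_cw R) :=
  [Finite of morse_matching X by <:].
HB.instance Definition _ (R : realType) (X : finite_cw R) :=
  [SubChoice_isSubPOrder of morse_matching X by <:
    with Order.SetSubsetOrder.subset_display].

(* The intersection poset L(A), ordered by reverse inclusion: [^d] is the dual
   of the inclusion order on sets. *)
Record flat (R : realType) (X : finite_cw R) := Flat {
  flat_set :> (set (X -> R))^d;
  _ : flat_set \in intersections (morse_arrangement X)
}.

HB.instance Definition _ (R : realType) (X : finite_cw R) :=
  [isSub for @flat_set R X].
HB.instance Definition _ (R : realType) (X : finite_cw R) :=
  [Choice of flat X by <:].
HB.instance Definition _ (R : realType) (X : finite_cw R) :=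
  [SubChoice_isSubPOrder of flat X by <: with Order.dual_display set_display].

(* Main.v *)
Require Import Defs.
From mathcomp Require Import all_boot all_order all_algebra.
From mathcomp Require Import all_classical all_reals all_analysis.

Local Open Scope classical_set_scope.

(** Since the edges of a matching N are pairwise disjoint, the points of the flat
of N are the functions on cells that agree on matched pairs and are otherwise
arbitrary. If such functions all satisfy [x s = x t] with [s != t], then s and t
are matched by N, as the indicator function of s and its partner shows. Hence N
can be recovered from its flat. *)

Lemma covers_asym (d : Order.disp_t) (P : finPOrderType d) (s t : P) :
  covers s t -> covers t s = false.
Proof.
move=> /andP[st _]; apply/negbTE/negP => /andP[ts _].
by have := Order.POrderTheory.lt_trans st ts; rewrite Order.POrderTheory.ltxx.
Qed.

Lemma covers_irrefl (d : Order.disp_t) (P : finPOrderType d) (s : P) :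
  covers s s = false.
Proof. by rewrite /covers Order.POrderTheory.ltxx. Qed.

Section MatchingFlat.
Variables (R : realType) (X : finite_cw R).
Implicit Types (M N : {set face_poset X * face_poset X}) (s t : face_poset X).

Definition matching_flat M : set (X -> R) :=
  \bigcap_(e in [set` M]) hyperplane e.2 e.1.

Lemma matching_flatS M N :
  M \subset N -> matching_flat N `<=` matching_flat M.
Proof. by move=> /fintype.subsetP MN x xN e /MN; exact: xN. Qed.

Lemma matching_flat_intersection M :
  (forall e, e \in M -> hasse_diagram X e.1 e.2) ->
  intersections (morse_arrangement X) (matching_flat M).
Proof.
move=> MD; exists [set hyperplane e.2 e.1 | e in [set` M]].
  by move=> _ [[t s] /MD st <-]; exists (s, t).
by rewrite bigcap_image.
Qed.

(** Applied to each edge of another matching, this turns a containment of flats into an inclusion of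
    matchings. *)
Lemma matching_flat_hyperplane N s t :
  matching (hasse_diagram X) N -> covers s t ->
  matching_flat N `<=` hyperplane s t -> (t, s) \in N.
Proof.
move=> [ND Ndisj] st Nst.
(* [A] consists of [s] and its partner in [N], if any; the partner may be the larger or the smaller
   cell of the edge. *)
pose A := [pred u : face_poset X | [|| u == s, (u, s) \in N | (s, u) \in N]].
pose x (u : X) : R := ((A u)%:R)%R.
(* An edge of [N] with one end in [A] meets the edge at [s] or contains [s], so by disjointness both
   its ends lie in [A]. *)
have NA a b : (a, b) \in N -> A a = A b.
  move=> abN; have disj := Ndisj _ _ abN.
  apply/idP/idP => /or3P[/eqP eqs|usN|suN]; apply/or3P.
  - by rewrite -eqs abN; constructor 3.
  - have /(congr1 snd)/= -> : (a, b) = (a, s)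
      by apply: (disj _ usN a); rewrite !inE eqxx.
    by constructor 1.
  - have /(congr1 fst)/= <- : (a, b) = (s, a)
      by apply: (disj _ suN a); rewrite !inE eqxx ?orbT.
    by rewrite abN; constructor 3.
  - by rewrite -eqs abN; constructor 2.
  - have /(congr1 snd)/= <- : (a, b) = (b, s)
      by apply: (disj _ usN b); rewrite !inE eqxx ?orbT.
    by rewrite abN; constructor 2.
  - have /(congr1 fst)/= -> : (a, b) = (s, b)
      by apply: (disj _ suN b); rewrite !inE eqxx ?orbT.
    by constructor 1.
have xN : matching_flat N x.
  by move=> [a b] abN; rewrite /hyperplane /= /x (NA _ _ abN).
have As : A s by rewrite /= eqxx.
have /eqP : x s = x t by exact: Nst xN.
rewrite /x As Num.Theory.eqr_nat; case At: (A t) => // _.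
(* Of the three ways for [t] to lie in [A], [t = s] and [(s, t) \in N] contradict that [t] covers
   [s]. *)
case/or3P: At => [/eqP ts|//|/ND].
  by move: st; rewrite ts covers_irrefl.
by rewrite /hasse_diagram /= (covers_asym _ _ _ _ st).
Qed.

End MatchingFlat.

Theorem proposition4p17 (R : realType) (X : finite_cw R) :
  exists f : morse_matching X -> flat X,
    (forall M : morse_matching X,
      flat_set (f M) = \bigcap_(e in [set` matching_edges M]) hyperplane e.2 e.1) /\
    {mono f : M N / (M <= N)%O >-> (M <= N)%O}.
Proof.
have matchingP (M : morse_matching X) : matching (hasse_diagram X) M.
  by case: M => M /=; rewrite inE => /andP[_ /asboolP[]].
have flatP (M : morse_matching X) :
    matching_flat _ X M \in intersections (morse_arrangement X).
  by apply/mem_set/matching_flat_intersection; case: (matchingP M).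
exists (fun M => @Flat R X _ (flatP M)); split=> // M N.
(* The order on flats is dual, so [NM] puts the flat of [N] inside that of [M]. Since the order is
   also reflected, antisymmetry makes the map injective. *)
apply/idP/idP => [/subsetPset NM|MN].
  apply/fintype.subsetP => -[t s] tsM.
  apply: (matching_flat_hyperplane _ _ _ _ _ (matchingP N)).
    by have [MD _] := matchingP M; exact: MD tsM.
  by move=> x /NM xM; exact: xM tsM.
by apply/subsetPset; exact: matching_flatS.
Qed.
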